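(* For every integer $k\ge 3$, $$R(4,3;k,1)\le R(4,3;k-1,1)+\frac 32+\sqrt{R(4,3;k-1,1)-\frac 34}.$$
   Context: All graphs are finite and simple. For positive integers $n,r,k,s$ with $n,k\ge 2$, the generalized Ramsey number $R(n,r;k,s)$ is the smallest positive integer $p$ such that for every graph $G$ of order $p$ (i.e. with $p$ vertices), either $G$ contains a subgraph induced by $n$ vertices with at most $r-1$ edges, or the complement $\overline G$ of $G$ contains a subgraph induced by $k$ vertices with at most $s-1$ edges. *)

(* Defs.v *)
From mathcomp Require Import all_boot.

Set Implicit Arguments.
Unset Strict Implicit.
Unset Printing Implicit Defensive.

Record sgraph (V : finType) := SGraph {
  adj :> rel V;
  adj_sym : symmetric adj;
  adj_irr : irreflexive adj }.

Definition compl_rel (V : finType) (G : sgraph V) : rel V :=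
  [rel x y | (x != y) && ~~ adj G x y].

Lemma compl_rel_sym (V : finType) (G : sgraph V) : symmetric (compl_rel G).
Proof. by move=> x y; rewrite /compl_rel /= [x == y]eq_sym adj_sym. Qed.

Lemma compl_rel_irr (V : finType) (G : sgraph V) : irreflexive (compl_rel G).
Proof. by move=> x; rewrite /compl_rel /= eqxx. Qed.

Definition compl (V : finType) (G : sgraph V) : sgraph V :=
  SGraph (@compl_rel_sym V G) (@compl_rel_irr V G).

(* The edge set of the subgraph of G induced by S; an edge is the
   two-element set of its endpoints, so each edge counts once. *)
Definition induced_edges (V : finType) (G : sgraph V) (S : {set V}) :
    {set {set V}} :=
  [set [set x; y] | x in S, y in S & adj G x y].

Definition sparse_subgraph (V : finType) (G : sgraph V) (n m : nat) : bool :=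
  [exists S : {set V}, (#|S| == n) && (#|induced_edges G S| <= m)].

(* For r = 0 or s = 0, outside the intended domain, r.-1 and s.-1 are 0. *)
Definition ramsey_prop (n r k s p : nat) : Prop :=
  forall (V : finType) (G : sgraph V), #|V| = p ->
    sparse_subgraph G n r.-1 \/ sparse_subgraph (compl G) k s.-1.

Lemma sparse_subgraph_iso (V W : finType) (f : V -> W) (G : sgraph V)
    (H : sgraph W) (n m : nat) :
  injective f -> (forall x y, adj H (f x) (f y) = adj G x y) ->
  sparse_subgraph G n m -> sparse_subgraph H n m.
Proof.
move=> f_inj fE /existsP[S /andP[/eqP Sn Sm]].
apply/existsP; exists (f @: S); rewrite card_imset // Sn eqxx /=.
apply: leq_trans Sm.
apply: leq_trans (leq_imset_card (fun E : {set V} => f @: E) _).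
apply/subset_leq_card/subsetP => E /imset2P[u v /imsetP[x xS ->]].
rewrite inE => /andP[/imsetP[y yS ->]]; rewrite fE => xy ->.
apply/imsetP; exists [set x; y]; last by rewrite imsetU !imset_set1.
by apply: imset2_f => //; rewrite inE yS.
Qed.

Section Decidability.
Variables n r k s p : nat.

Let mkrel (e : {ffun 'I_p * 'I_p -> bool}) : rel 'I_p :=
  fun x y => (x != y) && (e (x, y) || e (y, x)).

Let mkrel_sym e : symmetric (mkrel e).
Proof. by move=> x y; rewrite /mkrel [x == y]eq_sym orbC. Qed.

Let mkrel_irr e : irreflexive (mkrel e).
Proof. by move=> x; rewrite /mkrel eqxx. Qed.

Let mkgraph e := SGraph (@mkrel_sym e) (@mkrel_irr e).

Lemma ramsey_prop_dec : decidable (ramsey_prop n r k s p).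
Proof.
pose b := [forall e, sparse_subgraph (mkgraph e) n r.-1
                     || sparse_subgraph (compl (mkgraph e)) k s.-1].
apply: (@decP _ b); apply: (iffP forallP) => [allP V G Vp | H e].
- pose g (i : 'I_p) : V := enum_val (cast_ord (esym Vp) i).
  have g_inj : injective g by move=> i j /enum_val_inj /cast_ord_inj.
  pose e := [ffun ij : 'I_p * 'I_p => adj G (g ij.1) (g ij.2)].
  have gE x y : adj G (g x) (g y) = adj (mkgraph e) x y.
    rewrite /= /mkrel !ffunE /= [adj G (g y) _]adj_sym orbb.
    by case: eqVneq => //= ->; rewrite adj_irr.
  have /orP[H|H] := allP e; [left | right]; apply: sparse_subgraph_iso H.
  + exact: g_inj.
  + exact: gE.
  + exact: g_inj.
  + by move=> x y; rewrite /= /compl_rel /= (inj_eq g_inj) gE.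
- apply/orP; apply: H; exact: card_ord.
Qed.

End Decidability.

Lemma ramsey_sets (n k : nat) : exists N, forall (V : finType) (G : sgraph V)
    (A : {set V}), N <= #|A| ->
  (exists S : {set V}, [/\ S \subset A, #|S| = n
     & {in S &, forall x y, ~~ adj G x y}]) \/
  (exists S : {set V}, [/\ S \subset A, #|S| = k
     & {in S &, forall x y, ~~ adj (compl G) x y}]).
Proof.
elim: n k => [|n IHn] k.
  exists 0 => V G A _; left; exists set0; rewrite sub0set cards0.
  by split=> // x y; rewrite inE.
elim: k => [|k [N2 IHk]].
  exists 0 => V G A _; right; exists set0; rewrite sub0set cards0.
  by split=> // x y; rewrite inE.
have [N1 IH1] := IHn k.+1.
exists (N1 + N2).+1 => V G A leNA.
have /card_gt0P[x xA] : 0 < #|A| by apply: leq_trans leNA.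
pose B := [set y in A :\ x | adj G x y].
pose C := [set y in A :\ x | ~~ adj G x y].
have BCE : #|A| = (#|B| + #|C|).+1.
  rewrite (cardsD1 x) xA add1n -(cardsID [set y | adj G x y] (A :\ x)).
  by congr (_ + _).+1; apply: eq_card => y; rewrite !inE // andbC.
have subA (S D : {set V}) : S \subset D -> D \subset A :\ x ->
    [/\ S \subset A, x |: S \subset A & x \notin S].
  move=> SD DA; have SA := subset_trans SD DA.
  have SA' := subset_trans SA (subsetDl _ _).
  by split=> //; [rewrite subUset sub1set xA | move: SA; rewrite subsetD1; case/andP].
have BA : B \subset A :\ x by apply/subsetP => y; rewrite inE => /andP[].
have CA : C \subset A :\ x by apply/subsetP => y; rewrite inE => /andP[].
have ext (H : sgraph V) (S : {set V}) :
    {in S, forall y, ~~ adj H x y} -> {in S &, forall y z, ~~ adj H y z} ->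
    {in x |: S &, forall y z, ~~ adj H y z}.
  move=> xS SS y z /setU1P[->|yS] /setU1P[->|zS].
  - by rewrite adj_irr.
  - exact: xS.
  - by rewrite adj_sym xS.
  - exact: SS.
case: (leqP N1 #|C|) => [leC|ltC].
  case: (IH1 V G C leC) => [[S [SC Sn SS]]|[S [SC Sk SS]]];
    have [SA xSA xS] := subA _ _ SC CA.
    left; exists (x |: S); rewrite cardsU1 xS Sn; split=> //.
    by apply: ext SS => y /(subsetP SC); rewrite inE => /andP[].
  by right; exists S.
have leB : N2 <= #|B|.
  move: leNA; rewrite BCE ltnS => leNA.
  by rewrite -(leq_add2l N1) (leq_trans leNA) // addnC leq_add2r ltnW.
case: (IHk V G B leB) => [[S [SC Sn SS]]|[S [SC Sk SS]]];
  have [SA xSA xS] := subA _ _ SC BA.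
  by left; exists S.
right; exists (x |: S); rewrite cardsU1 xS Sk; split=> //.
apply: ext SS => y /(subsetP SC); rewrite inE => /andP[_ xy].
by rewrite /= /compl_rel /= xy andbF.
Qed.

Lemma ramsey_exists (n r k s : nat) :
  exists p, (0 < p) && ramsey_prop_dec n r k s p.
Proof.
have [N HN] := ramsey_sets n k; exists N.+1; apply/sumboolP => V G Vp.
have sparse (H : sgraph V) m q :
    (exists S : {set V}, [/\ S \subset setT, #|S| = m
       & {in S &, forall x y, ~~ adj H x y}]) -> sparse_subgraph H m q.
  case=> S [_ Sm SS]; apply/existsP; exists S; rewrite Sm eqxx /=.
  rewrite [induced_edges _ _](_ : _ = set0) ?cards0 //.
  apply/eqP; rewrite -subset0; apply/subsetP => E /imset2P[x y xS].
  by rewrite inE => /andP[yS]; rewrite (negbTE (SS x y xS yS)).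
by case: (HN V G setT); rewrite ?cardsT ?Vp // => /sparse; auto.
Qed.

Definition ramsey (n r k s : nat) : nat := ex_minn (ramsey_exists n r k s).

Lemma ramseyP (n r k s : nat) :
  [/\ 0 < ramsey n r k s, ramsey_prop n r k s (ramsey n r k s)
    & forall p, 0 < p -> ramsey_prop n r k s p -> ramsey n r k s <= p].
Proof.
rewrite /ramsey; case: ex_minnP => p /andP[p0 /sumboolP Hp] minp; split=> //.
by move=> q q0 Hq; apply: minp; rewrite q0; apply/sumboolP.
Qed.

(* Main.v *)
Require Import Defs.
From mathcomp Require Import all_boot all_order all_algebra.
From mathcomp Require Import zify lra.

Set Implicit Arguments.
Unset Strict Implicit.
Unset Printing Implicit Defensive.

Import Order.TTheory GRing.Theory Num.Theory.

(** Write m for R(4,3;k-1,1) and pass to the complement H of G. Six pairs lie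
    inside four vertices, so if G has no sparse 4-set then every four vertices
    span at most three edges of H. Hence H contains neither a 4-cycle nor a
    triangle with a pendant edge: these are the four-edge graphs on four
    vertices. The other alternative of the Ramsey property is an independent
    k-set of H.

    Suppose that G has m + d vertices, that it has no sparse 4-set and that H
    has no independent k-set. If H had a vertex v of degree below d, then at
    least m vertices would be neither v nor adjacent to v, and the definition
    of m would provide an independent (k-1)-set among them; adding v gives an
    independent k-set. So H has minimum degree at least d
    ([degree_lower_bound]). When d >= 3, every vertex of a triangle has a
    further neighbour, which would be pendant to it, so H has girth at least 5,
    and the Moore bound for diameter two ([moore_bound]) gives
    d^2 + 1 <= m + d. Thus m + d vertices force the Ramsey property for k as
    soon as d >= 3 and m + d <= d^2 ([ramsey_prop_step]).

    Applied with m + d = R(4,3;k,1) - 1, where the property fails by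
    minimality, this yields d^2 - d + 1 <= m; for d <= 2 the same inequality
    follows from m >= 4 ([ramsey_gt3]). It reads
    (d - 1/2)^2 <= m - 3/4, so R(4,3;k,1) = m + d + 1 is at most
    m + 3/2 + sqrt(m - 3/4). *)

Definition neighbours (V : finType) (H : sgraph V) (x : V) : {set V} :=
  [set y | adj H x y].

(** Double counting of the entries in the neighbourhoods of the neighbours
    of v. There are at least d * d of them, by the degree condition. On the
    other hand v occurs once for each of its neighbours, a neighbour of v never occurs
    (it would close a triangle), and each remaining vertex occurs at most once
    (twice would close a 4-cycle): at most #|V| - 1 in all. *)
Lemma moore_bound (V : finType) (H : sgraph V) (d : nat) (v : V) :
  (forall x, d <= #|neighbours H x|) ->
  (forall x y z, adj H x y -> adj H y z -> ~~ adj H x z) ->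
  (forall x y, x != y -> #|neighbours H x :&: neighbours H y| <= 1) ->
  d ^ 2 < #|V|.
Proof.
move=> degH noK3 noC4; set A := neighbours H v.
have vA : v \notin A by rewrite inE adj_irr.
have lower : d * d <= \sum_(u in A) #|neighbours H u|.
  apply: (@leq_trans (#|A| * d)); first by rewrite leq_mul2r degH orbT.
  by rewrite -sum_nat_const; apply: leq_sum => u _; apply: degH.
(* The right-hand side counts, for each vertex w, how often w occurs. *)
have countE : \sum_(u in A) #|neighbours H u| =
    \sum_w #|neighbours H w :&: A|.
  have -> : \sum_(u in A) #|neighbours H u| =
      \sum_(u in A) \sum_(w | adj H u w) 1.
    by apply: eq_bigr => u _; rewrite sum1_card; apply: eq_card => w; rewrite inE.
  rewrite (exchange_big_dep predT) //=; apply: eq_bigr => w _.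
  rewrite sum1_card; apply: eq_card => u; rewrite unfold_in.
  by rewrite !inE andbC adj_sym.
have onv : #|neighbours H v :&: A| = #|A| by rewrite setIid.
have offv : (\sum_(w | w != v) #|neighbours H w :&: A|
             <= \sum_(w | w != v) (w \notin A)).
  apply: leq_sum => w wv; case: (boolP (w \in A)) => [wA | _]; last exact: noC4.
  rewrite leqn0 cards_eq0 -subset0; apply/subsetP => u.
  rewrite !inE => /andP[wu vu]; move: wA; rewrite inE => vw.
  by move: (noK3 _ _ _ vw wu); rewrite vu.
have rest : (\sum_(w | w != v) (w \notin A) + #|A|).+1 = #|V|.
  rewrite -[RHS]sum1_card [in RHS](bigD1 v) //= add1n; congr _.+1.
  rewrite [X in (_ + X)](_ : _ = \sum_(w | w != v) (w \in A)).
    by rewrite -big_split; apply: eq_bigr => w _; case: (w \in A).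
  rewrite -sum1_card [LHS]big_mkcond [RHS]big_mkcond /=.
  apply: eq_bigr => w _; case: eqVneq => [-> | _]; last by case: (w \in A).
  by rewrite (negbTE vA).
rewrite -rest ltnS -mulnn (leq_trans lower) // countE (bigD1 v) //= onv addnC.
by rewrite leq_add2r.
Qed.

(** The form in which a forbidden configuration on four vertices is used: when
    the complement has four of the six pairs, G has at most the two others. *)
Lemma sparse_subgraph_of_two_pairs (V : finType) (G : sgraph V)
    (a b c e : V) (p q : {set V}) :
  uniq [:: a; b; c; e] ->
  {in [:: a; b; c; e] &, forall x y, adj G x y ->
     [set x; y] \in [set p; q]} ->
  sparse_subgraph G 4 2.
Proof.
move=> abce_uniq few; apply/existsP; exists [set x in [:: a; b; c; e]].
rewrite cardsE (card_uniqP abce_uniq) eqxx /=.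
apply: leq_trans (_ : #|[set p; q]| <= 2); last by rewrite cards2; case: eqP.
apply/subset_leq_card/subsetP => E /imset2P[x y xS].
rewrite !inE in xS *; move=> /andP[yS xy] ->.
by have := few x y; rewrite !inE; apply.
Qed.

Lemma sparse_subgraph0P (V : finType) (G : sgraph V) (n : nat) :
  reflect (exists2 S : {set V}, #|S| = n & {in S &, forall x y, ~~ adj G x y})
          (sparse_subgraph G n 0).
Proof.
apply: (iffP existsP) => [[S /andP[/eqP Sn noE]] | [S Sn indepS]]; exists S => //.
  move=> x y xS yS; apply/negP => xy; move: noE; rewrite leqn0 cards_eq0.
  move=> /eqP no_edge; have : [set x; y] \in induced_edges G S.
    by apply: imset2_f => //; rewrite inE yS.
  by rewrite no_edge inE.
rewrite Sn eqxx leqn0 cards_eq0 -subset0; apply/subsetP => E /imset2P[x y xS].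
by rewrite inE => /andP[yS]; rewrite (negbTE (indepS x y xS yS)).
Qed.

Lemma exists_subset_card (V : finType) (A : {set V}) (n : nat) :
  n <= #|A| -> exists2 B : {set V}, B \subset A & #|B| = n.
Proof.
case/card_geqP => s [s_uniq s_size sA]; exists [set x in s].
  by apply/subsetP => x; rewrite inE => /sA.
by rewrite cardsE (card_uniqP s_uniq).
Qed.

(** The Ramsey property of order p localizes to any set A of at least p
    vertices; the independent set is asserted to lie inside A so that it can be
    extended by a vertex chosen outside A. *)
Lemma ramsey_prop_subset (n r k p : nat) (V : finType) (G : sgraph V)
    (A : {set V}) :
  ramsey_prop n r k 1 p -> p <= #|A| ->
  sparse_subgraph G n r.-1 \/
  exists S : {set V}, [/\ S \subset A, #|S| = k
    & {in S &, forall x y, ~~ adj (compl G) x y}].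
Proof.
move=> Rp /exists_subset_card[B BA Bp].
pose W := {x : V | x \in B}.
pose e : rel W := fun x y => adj G (val x) (val y).
have e_sym : symmetric e by move=> x y; rewrite /e adj_sym.
have e_irr : irreflexive e by move=> x; rewrite /e adj_irr.
have Wp : #|{: W}| = p by rewrite card_sig.
have [sparseG | /sparse_subgraph0P[S Sk indepS]] := Rp _ (SGraph e_sym e_irr) Wp.
  by left; apply: sparse_subgraph_iso sparseG; first exact: val_inj.
right; exists [set val x | x in S]; split.
- by apply/subsetP => _ /imsetP[x _ ->]; apply: (subsetP BA); apply: valP.
- by rewrite card_imset //; apply: val_inj.
- move=> _ _ /imsetP[x xS ->] /imsetP[y yS ->].
  by have := indepS x y xS yS; rewrite /= /compl_rel /= (inj_eq val_inj).
Qed.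

(** A vertex v of smaller degree in the complement would leave m vertices
    outside its closed neighbourhood, hence an independent set of size k there,
    to which v can be added. *)
Lemma degree_lower_bound (k m d : nat) (V : finType) (G : sgraph V) (v : V) :
  ramsey_prop 4 3 k 1 m -> #|V| = m + d ->
  ~~ sparse_subgraph G 4 2 -> ~~ sparse_subgraph (compl G) k.+1 0 ->
  d <= #|neighbours (compl G) v|.
Proof.
move=> Rm Vmd /negP noG noK; rewrite leqNgt; apply: contra noK => small_deg.
have vN : v \notin neighbours (compl G) v by rewrite inE adj_irr.
have large : m <= #|~: (v |: neighbours (compl G) v)|.
  by have := cardsC (v |: neighbours (compl G) v); rewrite cardsU1 vN; lia.
have [//|[S [SA Sk indepS]]] := ramsey_prop_subset G Rm large.
have off_v x : x \in S -> (x != v) && ~~ adj (compl G) v x.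
  by move/(subsetP SA); rewrite !inE negb_or.
apply/sparse_subgraph0P; exists (v |: S).
  by rewrite cardsU1 Sk; case: (boolP (v \in S)) => // /off_v; rewrite eqxx.
move=> x y /setU1P[->|xS] /setU1P[->|yS]; last exact: indepS.
- by rewrite adj_irr.
- by have /andP[] := off_v y yS.
- by rewrite adj_sym; have /andP[] := off_v x xS.
Qed.

(** Two common neighbours u, w of x and y form the 4-cycle x u y w in the
    complement, which leaves only the pairs xy and uw to G. *)
Lemma compl_no_common_neighbours (V : finType) (G : sgraph V) (x y : V) :
  ~~ sparse_subgraph G 4 2 -> x != y ->
  #|neighbours (compl G) x :&: neighbours (compl G) y| <= 1.
Proof.
move=> noG xy; rewrite leqNgt; apply: contra noG => /card_gt1P[u [w []]].
rewrite !inE /compl_rel /= => /andP[/andP[xu nxu] /andP[yu nyu]].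
move=> /andP[/andP[xw nxw] /andP[yw nyw]] uw.
apply: (@sparse_subgraph_of_two_pairs _ _ x y u w [set x; y] [set u; w]).
  by rewrite /= !inE !negb_or xy xu xw yu yw uw.
have nonadj := (negbTE nxu, negbTE nyu, negbTE nxw, negbTE nyw).
have swap := (setUC [set y] [set x], setUC [set w] [set u]).
by move=> a b; rewrite !inE => /or4P[] /eqP-> /or4P[] /eqP->;
  rewrite ?adj_irr ?nonadj ?[adj G u _]adj_sym ?[adj G w _]adj_sym ?nonadj
    ?swap ?eqxx ?orbT.
Qed.

(** A third neighbour w of x turns a triangle x y z of the complement into a
    triangle with a pendant edge, which leaves only the pairs yw and zw to G.
    The degree condition cannot be dropped: a triangle may be a whole component
    of the complement. *)
Lemma compl_no_triangle (V : finType) (G : sgraph V) (x y z : V) :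
  ~~ sparse_subgraph G 4 2 -> 2 < #|neighbours (compl G) x| ->
  adj (compl G) x y -> adj (compl G) y z -> ~~ adj (compl G) x z.
Proof.
move=> noG deg_x hxy hyz; apply: contra noG => hxz.
have [w] : exists w, w \in neighbours (compl G) x :\: [set y; z].
  apply/card_gt0P; rewrite cardsD subn_gt0.
  apply: leq_ltn_trans deg_x; apply: leq_trans (subset_leq_card (subsetIr _ _)) _.
  by rewrite cards2; case: eqP.
move: hxy hyz hxz; rewrite !inE /= /compl_rel /= negb_or.
move=> /andP[xy nxy] /andP[yz nyz] /andP[xz nxz].
move=> /andP[/andP[wy wz] /andP[xw nxw]].
apply: (@sparse_subgraph_of_two_pairs _ _ x y z w [set y; w] [set z; w]).
  by rewrite /= !inE !negb_or xy xz xw yz ![_ == w]eq_sym wy wz.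
have nonadj := (negbTE nxy, negbTE nyz, negbTE nxz, negbTE nxw).
have swap := (setUC [set w] [set y], setUC [set w] [set z]).
by move=> a b; rewrite !inE => /or4P[] /eqP-> /or4P[] /eqP->;
  rewrite ?adj_irr ?nonadj ?[adj G _ x]adj_sym ?[adj G z y]adj_sym ?nonadj
    ?swap ?eqxx ?orbT.
Qed.

(** One of the two alternatives must hold, since otherwise the complement would
    have girth at least 5 and minimum degree d on at most d^2 vertices. *)
Lemma ramsey_prop_step (k m d : nat) :
  ramsey_prop 4 3 k 1 m -> 2 < d -> m + d <= d ^ 2 ->
  ramsey_prop 4 3 k.+1 1 (m + d).
Proof.
move=> Rm d_gt2 small V G Vmd.
case: (boolP (sparse_subgraph G 4 2)) => [|noG]; first by left.
case: (boolP (sparse_subgraph (compl G) k.+1 0)) => [|noK]; first by right.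
have [v _] : exists v, v \in [set: V].
  by apply/card_gt0P; rewrite cardsT Vmd; lia.
have deg x := degree_lower_bound x Rm Vmd noG noK.
suff : d ^ 2 < #|V| by rewrite Vmd ltnNge small.
apply: (moore_bound v deg) => [x y z | x y]; last exact: compl_no_common_neighbours.
by apply: compl_no_triangle => //; apply: leq_trans (deg x).
Qed.

(** The edgeless graph on at most three vertices has no 4-set at all, and its
    complement is complete, so has no two independent vertices. *)
Lemma ramsey_gt3 (k : nat) : 2 <= k -> 3 < ramsey 4 3 k 1.
Proof.
move=> k2; have [p_gt0 Rp _] := ramseyP 4 3 k 1; rewrite ltnNge; apply/negP.
move: (ramsey 4 3 k 1) p_gt0 Rp => p p_gt0 Rp p_le3.
have sym : symmetric (fun _ _ : 'I_p => false) by [].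
have irr : irreflexive (fun _ _ : 'I_p => false) by [].
have [|/sparse_subgraph0P[S Sk indepS]] := Rp _ (SGraph sym irr) (card_ord p).
  case/existsP => S /andP[/eqP S4 _].
  by have := max_card (mem S); rewrite S4 card_ord; lia.
have /card_gt1P[x [y [xS yS xy]]] : 1 < #|S| by rewrite Sk.
by have := indepS x y xS yS; rewrite /= /compl_rel /= xy.
Qed.

Local Open Scope ring_scope.

Theorem theorem5p2 (R : rcfType) (k : nat) (hk : (3 <= k)%N) :
  (ramsey 4 3 k 1)%:R <=
    (ramsey 4 3 (k - 1) 1)%:R + 3 / 2
    + Num.sqrt ((ramsey 4 3 (k - 1) 1)%:R - 3 / 4) :> R.
Proof.
have m_gt3 : (3 < ramsey 4 3 (k - 1) 1)%N by apply: ramsey_gt3; lia.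
have [_ Rm _] := ramseyP 4 3 (k - 1) 1.
have [_ _ minN] := ramseyP 4 3 k 1.
move: (ramsey 4 3 (k - 1) 1) (ramsey 4 3 k 1) m_gt3 Rm minN => m N m_gt3 Rm minN.
(* Here d is N - m - 1, truncated at 0: when N > m + 1, the Ramsey property
   fails on m + d = N - 1 vertices. *)
have [d Nmd dm] : exists2 d, (N <= m + d.+1)%N & (d ^ 2 < m + d)%N.
  have [N_le | N_gt] := leqP N m.+1; first by exists 0; lia.
  have [d Nd] : exists d, N = (m + d.+1)%N by exists (N - m.+1)%N; lia.
  exists d; first by rewrite Nd.
  have [d_le2 | d_gt2] := leqP d 2.
    by move: d d_le2 {Nd} => [|[|[|]]] // _; lia.
  rewrite ltnNge; apply/negP => small.
  have := ramsey_prop_step Rm d_gt2 small.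
  have -> : (k - 1).+1 = k by lia.
  by move/minN => /(_ ltac:(lia)); lia.
have NmdR : N%:R <= m%:R + d%:R + 1 :> R.
  by rewrite -natrD natr1 ler_nat -addnS.
have dmR : d%:R ^+ 2 + 1 <= m%:R + d%:R :> R.
  by rewrite -natrX natr1 -natrD ler_nat.
(* Completing the square: d^2 - d + 1 = (d - 1/2)^2 + 3/4. *)
have : d%:R - 1 / 2 <= Num.sqrt (m%:R - 3 / 4) :> R.
  apply: le_trans (ler_norm _) _; rewrite -sqrtr_sqr ler_wsqrtr //.
  by nra.
lra.
Qed.
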